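(* Let $B$ be an $n \times n$ matrix over an algebraically closed field $F$ of characteristic $0$ or $p > n$. Let $\lambda \in F$ be an eigenvalue of $B$. Let $C$ be the $2n \times 2n$ block upper triangular matrix $C = \begin{bmatrix} B & B \\ 0 & B \end{bmatrix}$. Let $(m_1,m_2,\ldots,m_r)$ and $(n_1,n_2,\ldots,n_s)$ be the Weyr structures associated with $\lambda$ of $B$ and $C$, respectively. Then: (1) If $\lambda = 0$, then $s = r$ and $n_i = 2m_i$ for all $i$. (2) If $\lambda \neq 0$ and $r = 1$, then $s = 2$ and $n_1 = n_2 = m_1$. (3) If $\lambda \neq 0$ and $r > 1$, then $s = r+1$ and (a) $n_1 = m_1 + m_2$, (b) $n_{s-1} = m_{s-2}$ and $n_s = m_{s-1}$, (c) $n_i = m_{i-1} + m_{i+1}$ for $2 \le i \le s-2$.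
   Context: The Weyr structure of a square matrix $A$ associated with an eigenvalue $\lambda$ is the sequence $(n_1,\ldots,n_r)$, where $r$ is the least positive integer with $\operatorname{rank}(A-\lambda I)^r = \operatorname{rank}(A-\lambda I)^{r+1}$ and $n_i = \operatorname{rank}(A-\lambda I)^{i-1} - \operatorname{rank}(A-\lambda I)^i$ for $i=1,\ldots,r$. It satisfies $n_1 \ge n_2 \ge \cdots \ge n_r \ge 1$. Equivalently, it is the dual (conjugate) partition of the partition formed by the sizes of the Jordan blocks of $A$ with eigenvalue $\lambda$. *)

(* Defs.v *)
From HB Require Import structures.
From mathcomp Require Import all_boot all_order all_algebra.

Set Implicit Arguments.
Unset Strict Implicit.
Unset Printing Implicit Defensive.

Import GRing.Theory.
Local Open Scope ring_scope.

Definition shift_rank (F : fieldType) (n : nat) (A : 'M[F]_n) (a : F)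
    (k : nat) : nat :=
  \rank ((A - a%:M) ^+ k).

Lemma shift_rank_leq (F : fieldType) (n : nat) (A : 'M[F]_n) (a : F)
    (k : nat) :
  (shift_rank A a k.+1 <= shift_rank A a k)%N.
Proof.
by rewrite /shift_rank exprS; apply/mxrankS/submxMl.
Qed.

Lemma shift_rank_stable (F : fieldType) (n : nat) (A : 'M[F]_n) (a : F) :
  exists k : nat,
    (0 < k)%N && (shift_rank A a k == shift_rank A a k.+1).
Proof.
have [/existsP[k Hk]|/existsPn noK] :=
  boolP [exists k : 'I_n.+1,
           shift_rank A a k.+1 == shift_rank A a k.+2]; first by exists k.+1.
have bound j : (j <= n.+1 -> shift_rank A a j.+1 + j <= n)%N.
  elim: j => [_|j IHj lt_jn]; first by rewrite addn0 rank_leq_row.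
  apply: leq_trans (IHj (ltnW lt_jn)).
  rewrite addnS -addSn leq_add2r ltn_neqAle shift_rank_leq andbT eq_sym.
  exact: (noK (Ordinal lt_jn)).
have := leq_trans (leq_addl _ _) (bound n.+1 (leqnn _)).
by rewrite ltnn.
Qed.

Definition weyr_index (F : fieldType) (n : nat) (A : 'M[F]_n) (a : F) : nat :=
  ex_minn (shift_rank_stable A a).

(* The subtraction is on nat, but it never truncates, by [shift_rank_leq]. *)
Definition weyr_structure (F : fieldType) (n : nat) (A : 'M[F]_n) (a : F) :
    seq nat :=
  [seq (shift_rank A a i.-1 - shift_rank A a i)%N
     | i <- iota 1 (weyr_index A a)].

(* One-based access: [part s i] is the i-th entry of s, for 1 <= i <= size s. *)
Definition part (s : seq nat) (i : nat) : nat := nth 0%N s i.-1.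

(* Main.v *)
(* Put N = B - lambda, so that (C - lambda)^k has diagonal blocks N^k and
   upper right block k N^(k-1) B. For lambda = 0 column operations leave
   diag(N^k, N^k). For lambda <> 0 and k nonzero in F, unimodular operations
   over F[N] bring it to diag(N^(k-1), N^(k+1)), as B is lambda modulo N. The
   ranks of the N^k are constant from k = n on, so the resulting formula
   rank (C - lambda)^k = rank N^(k-1) + rank N^(k+1) also holds for those k >= 1
   which vanish in F, because these exceed n. *)
Require Import Defs.
From HB Require Import structures.
From mathcomp Require Import all_boot all_order all_algebra.
From mathcomp Require Import zify.

Set Implicit Arguments.
Unset Strict Implicit.
Unset Printing Implicit Defensive.

Import GRing.Theory.
Local Open Scope ring_scope.

(** * Rank sequences of powers and the Weyr index *)

Lemma shift_rank0 (F : fieldType) (n : nat) (A : 'M[F]_n) (a : F) :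
  shift_rank A a 0 = n.
Proof. by rewrite /shift_rank expr0 mxrank1. Qed.

Lemma shift_rank1_lt (F : fieldType) (n : nat) (A : 'M[F]_n) (a : F) :
  eigenvalue A a -> (shift_rank A a 1 < shift_rank A a 0)%N.
Proof.
rewrite shift_rank0 /shift_rank expr1 /eigenvalue /eigenspace -mxrank_eq0.
by rewrite mxrank_ker subn_eq0 -ltnNge.
Qed.

(** Equal ranks make the nested row spaces of [N ^+ k.+1] and [N ^+ k] equal, and right
    multiplication by [N] preserves this equality. *)
Lemma shift_rank_stableS (F : fieldType) (n : nat) (A : 'M[F]_n) (a : F) k :
  shift_rank A a k = shift_rank A a k.+1 ->
  shift_rank A a k.+1 = shift_rank A a k.+2.
Proof.
rewrite /shift_rank; set N := A - a%:M => eq_rk.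
have sub : (N ^+ k.+1 <= N ^+ k)%MS by rewrite exprS; apply: submxMl.
have /eqmxP eqN : (N ^+ k.+1 == N ^+ k)%MS.
  by rewrite -mxrank_leqif_eq // eq_rk.
by rewrite (exprSr _ k) (exprSr _ k.+1) -!mulmxE (eqmxMr N eqN).
Qed.

(** Strict decrease starts at [k = 1]: the index is a minimum over positive exponents, so it says
    nothing about the step from 0 to 1. *)
Variant weyr_index_spec (F : fieldType) (n : nat) (A : 'M[F]_n) (a : F) :
    nat -> Prop :=
  WeyrIndexSpec r of (0 < r)%N
    & (forall k, (0 < k < r)%N -> (shift_rank A a k.+1 < shift_rank A a k)%N)
    & (forall k, (r <= k)%N -> shift_rank A a k.+1 = shift_rank A a k)
  : weyr_index_spec A a r.

Lemma weyr_indexP (F : fieldType) (n : nat) (A : 'M[F]_n) (a : F) :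
  weyr_index_spec A a (weyr_index A a).
Proof.
rewrite /weyr_index; case: ex_minnP => r /andP[r_gt0 /eqP eq_r] min_r.
split=> // [k /andP[k_gt0 lt_kr]|k le_rk].
  rewrite ltn_neqAle shift_rank_leq andbT eq_sym.
  by apply: contraL lt_kr => eq_k; rewrite -leqNgt min_r ?k_gt0.
rewrite -(subnK le_rk); elim: (k - r)%N => [//|d IHd].
by rewrite addSn; symmetry; apply/shift_rank_stableS.
Qed.

Lemma weyr_index_unique (F : fieldType) (n : nat) (A : 'M[F]_n) (a : F) r :
  (0 < r)%N -> shift_rank A a r.+1 = shift_rank A a r ->
  (forall k, (0 < k < r)%N -> shift_rank A a k.+1 <> shift_rank A a k) ->
  weyr_index A a = r.
Proof.
move=> r_gt0 eq_r neq; case: (weyr_indexP A a) => t t_gt0 lt_t eq_t.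
case: (ltngtP t r) => // [lt_tr|lt_rt].
  by case: (neq t); rewrite ?t_gt0 ?eq_t.
by have := lt_t r; rewrite r_gt0 lt_rt eq_r ltnn => /(_ isT).
Qed.

(** The ranks start at [n] and drop by at least one at each step until they stabilise, so at most
    [n] drops occur. *)
Lemma shift_rank_stable_size (F : fieldType) (n : nat) (A : 'M[F]_n) (a : F) k :
  (n <= k)%N -> shift_rank A a k.+1 = shift_rank A a k.
Proof.
case: (eqVneq (shift_rank A a 1) (shift_rank A a 0)) => [eq0 _|neq0].
  by elim: k => // k IHk; apply/esym/shift_rank_stableS.
case: (weyr_indexP A a) => r r_gt0 lt_r eq_r le_nk; apply: eq_r.
apply: leq_trans le_nk.
have bound j : (j <= r -> shift_rank A a j + j <= n)%N.
  elim: j => [_|j IHj lt_jr]; first by rewrite shift_rank0 addn0.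
  apply: leq_trans (IHj (ltnW lt_jr)); rewrite addnS -addSn leq_add2r.
  case: j {IHj} lt_jr => [_|j lt_jr]; last exact: lt_r.
  by rewrite ltn_neqAle neq0 shift_rank_leq.
exact: leq_trans (leq_addl _ _) (bound r (leqnn r)).
Qed.

Lemma size_weyr_structure (F : fieldType) (n : nat) (A : 'M[F]_n) (a : F) :
  size (weyr_structure A a) = weyr_index A a.
Proof. by rewrite size_map size_iota. Qed.

Lemma part_weyr_structure (F : fieldType) (n : nat) (A : 'M[F]_n) (a : F) i :
  (0 < i)%N ->
  part (weyr_structure A a) i = (shift_rank A a i.-1 - shift_rank A a i)%N.
Proof.
case: i => // i _; rewrite /part /=.
have [lt_i|le_i] := ltnP i (weyr_index A a).
  by rewrite (nth_map 0%N) ?size_iota // nth_iota.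
(* Past the end, the default 0 agrees with the difference of two stable ranks, so no upper bound on
   [i] is required. *)
rewrite nth_default ?size_weyr_structure //.
by case: (weyr_indexP A a) le_i => r _ _ eq_r /eq_r->; rewrite subnn.
Qed.

(** * Powers of the shifted block matrix and their ranks *)

Lemma block_mx_jordan_exprS (R : pzRingType) (n : nat) (N B : 'M[R]_n) k :
  GRing.comm B N ->
  (block_mx N B 0 N : 'M[R]_(n + n)) ^+ k.+1 =
    block_mx (N ^+ k.+1) (N ^+ k *m B *+ k.+1) 0 (N ^+ k.+1).
Proof.
move=> cBN; elim: k => [|k IHk]; first by rewrite !expr1 expr0 mul1mx mulr1n.
rewrite exprS IHk -[LHS]/(_ *m _) mulmx_block !mul0mx !mulmx0 !addr0 add0r.
rewrite !mulmxE mulrnAr mulrA -!exprS; congr block_mx.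
by rewrite (commrX _ cBN) -mulrSr.
Qed.

Lemma comm_sub_scalar_mx (R : comPzRingType) (n : nat) (B : 'M[R]_n) (a : R) :
  GRing.comm B (B - a%:M).
Proof. by apply: commrB; rewrite // /GRing.comm -!mulmxE scalar_mxC. Qed.

Lemma doubled_shift_exprS (R : comPzRingType) (n : nat) (B : 'M[R]_n) (a : R) k :
  ((block_mx B B 0 B : 'M[R]_(n + n)) - a%:M) ^+ k.+1 =
    block_mx ((B - a%:M) ^+ k.+1) ((B - a%:M) ^+ k *m B *+ k.+1)
      0 ((B - a%:M) ^+ k.+1).
Proof.
rewrite -block_mx_jordan_exprS; last exact: comm_sub_scalar_mx.
by rewrite scalar_mx_block opp_block_mx add_block_mx !subr0.
Qed.

Lemma shift_rank_doubled_natr0 (F : fieldType) (n : nat) (B : 'M[F]_n) (a : F) k :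
  k.+1%:R = 0 :> F ->
  shift_rank (block_mx B B 0 B : 'M_(n + n)) a k.+1 =
    (2 * shift_rank B a k.+1)%N.
Proof.
move=> k0; rewrite /shift_rank doubled_shift_exprS -scaler_nat k0 scale0r.
by rewrite rank_diag_block_mx mul2n addnn.
Qed.

Lemma shift_rank_doubled_eq0 (F : fieldType) (n : nat) (B : 'M[F]_n) k :
  shift_rank (block_mx B B 0 B : 'M_(n + n)) 0 k = (2 * shift_rank B 0 k)%N.
Proof.
case: k => [|k]; first by rewrite !shift_rank0 mul2n addnn.
rewrite /shift_rank doubled_shift_exprS raddf0 subr0 mulmxE -exprSr.
(* The upper right block is now a scalar multiple of the diagonal one, so a unipotent right factor
   clears it. *)
have -> : block_mx (B ^+ k.+1) (B ^+ k.+1 *+ k.+1) 0 (B ^+ k.+1) =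
   block_mx (B ^+ k.+1) 0 0 (B ^+ k.+1) *m block_mx 1%:M (k.+1%:R%:M) 0 1%:M.
  rewrite mulmx_block !mulmx1 !mulmx0 !mul0mx !addr0 !add0r mul_mx_scalar.
  by rewrite scaler_nat.
rewrite mxrankMfree ?rank_diag_block_mx ?mul2n ?addnn //.
by rewrite row_free_unit unitmxE det_ublock !det1 mulr1 unitr1.
Qed.

Lemma shift_rank_doubled_neq0 (F : fieldType) (n : nat) (B : 'M[F]_n) (a : F) k :
  a != 0 -> k.+1%:R != 0 :> F ->
  shift_rank (block_mx B B 0 B : 'M_(n + n)) a k.+1 =
    (shift_rank B a k + shift_rank B a k.+2)%N.
Proof.
move=> a0 k0; rewrite /shift_rank doubled_shift_exprS -rank_diag_block_mx.
have := comm_sub_scalar_mx B a; have : B - (B - a%:M) = a%:M.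
  by rewrite opprB addrC subrK.
set N := B - a%:M => BN cBN.
(* With this [c], the lower blocks of the product below are [c N^(k+2) - c N^(k+2) = 0] and
   [a^-1 N^(k+1) (B - N) = N^(k+1)]. *)
pose c := (k.+1%:R * a)^-1.
have kc : k.+1%:R * c = a^-1 by rewrite /c invfM mulrA mulfV ?mul1r.
pose L : 'M[F]_(n + n) := block_mx 1%:M 0 (c *: N) 1%:M.
pose Q : 'M[F]_(n + n) :=
  block_mx N (k.+1%:R *: B) (- c)%:M (- a^-1)%:M.
(* The adjugate of [Q] as a 2 x 2 matrix over the commutative ring F[B]; the determinant there is
   [a^-1 (B - N) = 1]. *)
pose Q' : 'M[F]_(n + n) :=
  block_mx (- a^-1)%:M (- (k.+1%:R *: B)) c%:M N.
have unitL : row_full L.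
  by rewrite row_full_unit unitmxE det_lblock !det1 mulr1 unitr1.
have inv1 : a^-1 *: B - a^-1 *: N = 1%:M.
  by rewrite -scalerBr BN scale_scalar_mx mulVf.
have QQ' : Q *m Q' = 1%:M.
  rewrite mulmx_block scalar_mx_block; congr block_mx.
  - by rewrite !mul_mx_scalar scalerA mulrC kc scaleNr addrC.
  - by rewrite mulmxN -scalemxAr -scalemxAl !mulmxE cBN addrC subrr.
  - by rewrite -!scalar_mxM -raddfD /= mulrNN mulNr mulrC subrr raddf0.
  - by rewrite !mul_scalar_mx scalerN !scaleNr opprK scalerA mulrC kc.
have [unitQ _] := mulmx1_unit QQ'.
suff -> : block_mx (N ^+ k.+1) (N ^+ k *m B *+ k.+1) 0 (N ^+ k.+1) =
    L *m (block_mx (N ^+ k) 0 0 (N ^+ k.+2) *m Q).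
  by rewrite (eqmxMfull _ unitL) mxrankMfree ?row_free_unit.
have NN : N *m N ^+ k = N ^+ k.+1 by rewrite mulmxE -exprS.
rewrite !mulmx_block !mul0mx !mul1mx !addr0 !add0r; congr block_mx.
- by rewrite mulmxE -exprSr.
- by rewrite -scalemxAr scaler_nat.
- rewrite mul_mx_scalar scaleNr -scalemxAl !mulmxE -exprSr -exprS.
  by rewrite subrr.
- rewrite mul_mx_scalar scaleNr -scalemxAl -!scalemxAr scalerA [c * _]mulrC kc.
  rewrite mulmxA NN (exprSr _ k.+1) -!mulmxE -scalerBr -mulmxBr BN mul_mx_scalar.
  by rewrite scalerA mulVf // scale1r.
Qed.

Lemma shift_rank_doubledS (F : fieldType) (n : nat) (B : 'M[F]_n) (a : F) k :
  [pchar F] =i pred0 \/ (exists2 p : nat, p \in [pchar F] & (n < p)%N) ->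
  a != 0 ->
  shift_rank (block_mx B B 0 B : 'M_(n + n)) a k.+1 =
    (shift_rank B a k + shift_rank B a k.+2)%N.
Proof.
move=> char_F a0; have [k0|k0] := eqVneq (k.+1%:R : F) 0; last first.
  exact: shift_rank_doubled_neq0.
have le_nk : (n <= k)%N.
  case: char_F => [/pcharf0P char0|[p char_p lt_np]].
    by have := char0 k.+1; rewrite k0 eqxx.
  have : (p %| k.+1)%N by rewrite (dvdn_pcharf char_p) k0.
  by move/(dvdn_leq (ltn0Sn k)) => /(leq_trans lt_np).
(* The ranks of [B] at [k], [k.+1] and [k.+2] coincide, so twice the middle one is the sum of the
   outer two. *)
rewrite shift_rank_doubled_natr0 // !shift_rank_stable_size ?(leqW le_nk) //.
by rewrite mul2n addnn.
Qed.

(** * The Weyr structure of the doubled matrix *)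

Lemma weyr_index_doubled_eq0 (F : fieldType) (n : nat) (B : 'M[F]_n) :
  weyr_index (block_mx B B 0 B : 'M_(n + n)) 0 = weyr_index B 0.
Proof.
case: (weyr_indexP B 0) => r r_gt0 lt_r eq_r; apply: weyr_index_unique => //.
  by rewrite !shift_rank_doubled_eq0 eq_r.
by move=> k /lt_r; rewrite !shift_rank_doubled_eq0; lia.
Qed.

(** The rank drop of the doubled matrix from [k.+1] to [k.+2] is the sum of the drops of [B] from
    [k] to [k.+1] and from [k.+2] to [k.+3]. It is positive for [k < r] and zero for [k = r]. *)
Lemma weyr_index_doubled_neq0 (F : fieldType) (n : nat) (B : 'M[F]_n) (a : F) :
  [pchar F] =i pred0 \/ (exists2 p : nat, p \in [pchar F] & (n < p)%N) ->
  a != 0 -> eigenvalue B a ->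
  weyr_index (block_mx B B 0 B : 'M_(n + n)) a = (weyr_index B a).+1.
Proof.
move=> char_F a0 /shift_rank1_lt lt01.
case: (weyr_indexP B a) => r r_gt0 lt_r eq_r; apply: weyr_index_unique => //.
  by rewrite !shift_rank_doubledS // !eq_r //; lia.
case=> // k; rewrite !shift_rank_doubledS // => /= lt_kr.
have ltk : (shift_rank B a k.+1 < shift_rank B a k)%N.
  (* For [k = 0] the drop comes from [a] being an eigenvalue. *)
  by case: k lt_kr => // k lt_kr; apply: lt_r.
by have := shift_rank_leq B a k.+2; lia.
Qed.

Theorem theorem3p1 (F : closedFieldType) (n : nat) (B : 'M[F]_n) (lambda : F)
    (char_F : [pchar F] =i pred0 \/ exists2 p : nat, p \in [pchar F] & (n < p)%N)
    (lambda_eig : eigenvalue B lambda) :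
  let C : 'M[F]_(n + n) := block_mx B B 0 B in
  let m := part (weyr_structure B lambda) in
  let r := size (weyr_structure B lambda) in
  let nu := part (weyr_structure C lambda) in
  let s := size (weyr_structure C lambda) in
  [/\ lambda = 0 ->
        s = r /\ (forall i : nat, (1 <= i <= r)%N -> nu i = (2 * m i)%N),
      lambda != 0 -> r = 1%N ->
        [/\ s = 2%N, nu 1%N = m 1%N & nu 2%N = m 1%N]
    & lambda != 0 -> (1 < r)%N ->
        [/\ s = r.+1,
            nu 1%N = (m 1%N + m 2%N)%N,
            nu (s - 1)%N = m (s - 2)%N,
            nu s = m (s - 1)%N
          & forall i : nat, (2 <= i <= s - 2)%N ->
              nu i = (m (i - 1)%N + m (i + 1)%N)%N]].
Proof.
move=> C m r nu s.
have part_m i : (0 < i)%N ->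
    m i = (shift_rank B lambda i.-1 - shift_rank B lambda i)%N.
  exact: part_weyr_structure.
have part_nu i : (0 < i)%N ->
    nu i = (shift_rank C lambda i.-1 - shift_rank C lambda i)%N.
  exact: part_weyr_structure.
have m_default i : (r < i)%N -> m i = 0%N.
  by case: i => // i le_ri; apply: nth_default.
have [lambda0|lambda_neq0] := eqVneq lambda 0.
  split=> // _; split.
    by rewrite /s /r !size_weyr_structure lambda0 weyr_index_doubled_eq0.
  move=> i /andP[i_gt0 _]; rewrite part_nu // part_m // /C lambda0.
  by rewrite !shift_rank_doubled_eq0 mulnBr.
have eq_s : s = r.+1.
  by rewrite /s /r !size_weyr_structure; apply: weyr_index_doubled_neq0.
have le_rho := shift_rank_leq B lambda.
(* The first entry is separate because the rank formula covers positive powers only; the power 0 has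
   rank [n + n]. *)
have nu1 : nu 1%N = (m 1%N + m 2%N)%N.
  rewrite part_nu // !part_m //= shift_rank_doubledS // !shift_rank0.
  by have := le_rho 0%N; have := le_rho 1%N; rewrite !shift_rank0; lia.
(* This holds for every [i]; the end cases follow since [m] vanishes beyond [r]. *)
have nuSS i : nu i.+2 = (m i.+1 + m i.+3)%N.
  rewrite part_nu // !part_m //= !shift_rank_doubledS //.
  by have := le_rho i; have := le_rho i.+1; have := le_rho i.+2; lia.
split=> [lambda0||]; first by rewrite lambda0 eqxx in lambda_neq0.
  move=> _ r1; rewrite eq_s r1; split=> //.
    by rewrite nu1 (m_default 2%N) ?r1 ?addn0.
  by rewrite nuSS (m_default 3%N) ?r1 ?addn0.
(* With [r.+2] in place of [r], the last two entries of [nu] sit at [r.+2] and [r.+3]; their second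
   summands [m r.+3] and [m r.+4] are zero. *)
move=> _ r_gt1; rewrite eq_s; case: r r_gt1 m_default {eq_s} => [|[|r]] // _ m0.
rewrite !subSS !subn0; split=> // [||[|[|i]] // _].
- by rewrite nuSS (m0 r.+3) ?addn0.
- by rewrite nuSS (m0 r.+4) ?addn0.
- by rewrite nuSS subn1 addn1.
Qed.
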